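(* Let $G$ be a finite abelian group, written multiplicatively, and let $k$ be a positive integer. Let $A=\{a_1,\ldots,a_k\}$ be a $k$-subset of $G$ (so $a_1,\ldots,a_k$ are pairwise distinct), and let $b_1,\ldots,b_k$ be (not necessarily distinct) elements of $G$. Suppose that $H$ is a subgroup of $G$ such that $|H|$ is $k$-large and such that either $A\subseteq H$ or $B=\{b_1,\ldots,b_k\}\subseteq H$. Then there exists a permutation $\pi\in S_k$ such that the products $a_1b_{\pi(1)},\ldots,a_kb_{\pi(k)}$ are pairwise distinct.
   Context: $S_k$ is the symmetric group on $\{1,\ldots,k\}$. For positive integers $k$ and $n>1$, $n$ is called $k$-large if the smallest prime divisor of $n$ is greater than $k$ and any other prime divisor of $n$ (if there is any) is greater than $k!$. *)

(* Defs.v *)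
From mathcomp Require Import all_boot all_fingroup.

Set Implicit Arguments.
Unset Strict Implicit.
Unset Printing Implicit Defensive.

(* [pdiv n] is the smallest prime divisor of [n] when [1 < n]; prime divisors
   are taken without multiplicity, so every prime power [p ^ e.+1] with [k < p]
   is [k]-large. *)
Definition k_large (k n : nat) : Prop :=
  [/\ 1 < n,
      k < pdiv n
    & forall p : nat, prime p -> p %| n -> p != pdiv n -> k`! < p].

(* Main.v *)
Require Import Defs.
From mathcomp Require Import all_boot all_fingroup.
From mathcomp Require Import all_algebra all_solvable all_field all_character.

(** Suppose first that B lies in H.  Choose k irreducible characters chi_i of
    the abelian group G for which det (chi_i (a_j)) is nonzero; this is possible
    because the columns of the character table are independent.  As characters
    are multiplicative, expanding determinants gives
      sum_s det (chi_i (a_j b_(s j))) = det (chi_i (a_j)) * per (chi_i (b_j)),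
    the sum being over all permutations s ([sum_det_hadamard]).  If the
    permanent does not vanish, some determinant on the left is nonzero; its
    columns are then distinct, hence so are the products a_j b_(s j).

    The permanent is a sum of k! roots of unity whose orders divide |H|, and the
    arithmetic of |H| prevents it from vanishing.  Let p be the smallest prime
    divisor of |H|.  If N roots of unity of order dividing n add up to 0 and all
    prime divisors of n other than p exceed N, then p divides N
    ([vanishing_sum_dvd]).  For a prime q > N and n = q m, applying the Galois
    automorphisms z |-> z ^ (1 + m s) to the sum and inverting a discrete
    Fourier transform of length q shows that the terms with a given m-th power
    already add up to 0 ([vanishing_class_sum]).  Divided by one of them, the
    terms of such a class are m-th roots of unity, so all primes other than p
    can be stripped from n.  When n is a power of p, raising the sum to the n-th
    power gives 0 = N modulo p, by the Frobenius congruence.  Here N = k! is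
    prime to p > k.

    If instead A lies in H, compose b with a map from G to H that commutes with
    multiplication by elements of H: the products of the a_i with the resulting
    elements of H are the images of the products a_i b_j, and elements with
    distinct images are distinct. *)

Set Implicit Arguments.
Unset Strict Implicit.
Unset Printing Implicit Defensive.

(** * Vanishing sums of roots of unity *)

Section VanishingSums.

Import GRing.Theory Num.Theory.
Local Open Scope ring_scope.

(** The Frobenius congruence: the inner binomial coefficients are divisible by
    [p]. *)
Lemma eqAmod_exprD (p : nat) :
  prime p -> {in Aint &, forall x y, (x + y) ^+ p == x ^+ p + y ^+ p %[mod p]}%A.
Proof.
case: p => // p p_pr x y Zx Zy; rewrite exprDn big_ord_recl big_ord_recr /=.
rewrite subn0 subnn !expr0 mulr1 mul1r bin0 binn !mulr1n.
rewrite eqAmodDl -[X in (_ == X %[mod _])%A]add0r eqAmodDr eqAmod0.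
apply: rpred_sum => i _; rewrite -mulr_natr mulrC.
have /dvdnP[c ->] : (p.+1 %| 'C(p.+1, bump 0 i))%N.
  by apply: prime_dvd_bin; rewrite ?lift0 ?ltnS /=.
rewrite natrM -mulrA mulrC -mulrA -eqAmod0 eqAmodMr0 //.
by rewrite rpredM ?rpredM ?rpredX ?rpred_nat.
Qed.

Lemma eqAmod_expr_sum (p : nat) (I : finType) (S : {set I}) (x : I -> algC) :
  prime p -> {in S, forall i, x i \in Aint} ->
  ((\sum_(i in S) x i) ^+ p == \sum_(i in S) x i ^+ p %[mod p])%A.
Proof.
move=> p_pr Zx.
suff [] : (\sum_(i in S) x i \in Aint) /\
  ((\sum_(i in S) x i) ^+ p == \sum_(i in S) x i ^+ p %[mod p])%A by [].
elim/big_rec2: _ => [|i u v Si [Zv Euv]].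
  by split; rewrite ?rpred0 // expr0n gtn_eqF ?prime_gt0 ?eqAmod_refl.
split; first by rewrite rpredD ?Zx.
by apply: eqAmod_trans (eqAmod_exprD p_pr (Zx i Si) Zv) _; rewrite eqAmodDl.
Qed.

(** Raising the terms to the power [p] preserves the vanishing of their sum
    modulo [p], and after [e] such steps every term is 1. *)
Lemma prime_power_vanishing_sum (p e : nat) (I : finType) (S : {set I})
    (x : I -> algC) :
  prime p -> {in S, forall i, x i ^+ (p ^ e) = 1} ->
  \sum_(i in S) x i = 0 -> (p %| #|S|)%N.
Proof.
move=> p_pr; have p_gt0 := prime_gt0 p_pr => x1 sx0.
rewrite -eqAmod0_nat.
have: (\sum_(i in S) x i == 0 %[mod p])%A by rewrite sx0.
elim: e x x1 {sx0} => [|e IHe] x x1 sx0.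
  by move: sx0; rewrite (eq_bigr (fun=> 1)) ?sumr_const.
have Zx: {in S, forall i, x i \in Aint}.
  move=> i /x1 xi1; apply: (@Aint_unity_root (p ^ e.+1)).
    by rewrite expn_gt0 p_gt0.
  exact/unity_rootP.
apply: (IHe (fun i => x i ^+ p)) => [i /x1|]; first by rewrite expnS exprM.
have:= eqAmod_expr_sum p_pr Zx; rewrite eqAmod_sym => /eqAmod_trans; apply.
have Zs: \sum_(i in S) x i \in Aint by apply: rpred_sum.
have Zsp := rpredX p.-1 Zs; rewrite -(prednK p_gt0) exprS.
rewrite -[X in (_ == X %[mod _])%A](mul0r ((\sum_(i in S) x i) ^+ p.-1)).
by rewrite eqAmodMr // prednK.
Qed.

Lemma sum_expr_unity_root (q : nat) (u : algC) :
  u ^+ q = 1 -> \sum_(s < q) u ^+ s = q%:R *+ (u == 1).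
Proof.
move=> uq1; have [-> | u1] := eqVneq u 1.
  rewrite (eq_bigr (fun=> 1)) => [|s _]; last by rewrite expr1n.
  by rewrite sumr_const card_ord.
have /eqP := subrX1 u q; rewrite uq1 subrr eq_sym mulf_eq0 subr_eq0 (negPf u1).
by move/eqP=> ->.
Qed.

(** For [t] prime to [n], some field automorphism raises all [n]-th roots of
    unity to the power [t]. *)
Lemma galois_vanishing_sum (n t : nat) (I : finType) (S : {set I})
    (x : I -> algC) :
  {in S, forall i, x i ^+ n = 1} -> \sum_(i in S) x i = 0 ->
  coprime t n -> \sum_(i in S) x i ^+ t = 0.
Proof.
move=> x1 sx0 /Qn_aut_exists[u Eu].
transitivity (u (\sum_(i in S) x i)); last by rewrite sx0 rmorph0.
by rewrite rmorph_sum; apply: eq_bigr => i Si; rewrite Eu ?x1.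
Qed.

(** Prime factors of [m] never divide [1 + m * s].  If [q] divides [m], the same
    holds for [q]; otherwise [1 + m * s] runs through all residues modulo [q],
    and the only failure is the [s] that gives 0. *)
Lemma coprime_but_one (q m : nat) :
  prime q -> (0 < m)%N ->
  exists s0 : 'I_q, forall s : 'I_q, s != s0 -> coprime (1 + m * s) (q * m).
Proof.
move=> q_pr m_gt0.
have co (s : 'I_q) : ~~ (q %| 1 + m * s)%N -> coprime (1 + m * s) (q * m).
  move=> qs; rewrite coprimeMr coprime_sym prime_coprime // qs.
  by rewrite /coprime gcdnC addnC mulnC gcdnMDl gcdn1.
have uniq_le (s t : 'I_q) : (s <= t)%N ->
    (q %| 1 + m * s)%N -> (q %| 1 + m * t)%N -> t = s.
  move=> le_st qs qt.
  have q'm : coprime q m.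
    rewrite prime_coprime //; apply: contraL qs => qm.
    by rewrite addnC dvdn_addr ?dvdn_mulr // dvdn1 gtn_eqF ?prime_gt1.
  have q_st: (q %| t - s)%N.
    by rewrite -(Gauss_dvdr _ q'm) mulnBr -(subnDl 1) dvdn_sub.
  apply/val_inj/eqP; rewrite /= eqn_leq le_st andbT -subn_eq0.
  apply: contraLR q_st; rewrite -lt0n => st_gt0.
  by rewrite gtnNdvd // (leq_ltn_trans (leq_subr _ _)).
have [/existsP[s0 qs0] | /existsPn no_s] :=
  boolP [exists s : 'I_q, (q %| 1 + m * s)%N].
  exists s0 => s s0's; apply: co; apply: contraNN s0's => qs; apply/eqP.
  by case/orP: (leq_total s0 s) => le; [apply: uniq_le | apply/esym/uniq_le].
by exists (Ordinal (prime_gt0 q_pr)) => s _; apply/co/no_s.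
Qed.

Lemma root_of_unity_avoiding (q : nat) (I : finType) (S : {set I})
    (y : I -> algC) :
  (#|S| < q)%N -> exists2 w : algC, w ^+ q = 1 & {in S, forall i, y i != w}.
Proof.
move=> Sq; have q_gt0: (0 < q)%N by apply: leq_trans Sq.
have [z pr_z] := C_prim_root_exists q_gt0.
pose r := [seq z ^+ (j : 'I_q) | j <- enum 'I_q]; pose t := [seq y i | i in S].
have r_uniq : uniq r.
  rewrite map_inj_uniq ?enum_uniq // => i j /eqP.
  by rewrite (eq_prim_root_expr pr_z) !modn_small // => /eqP/val_inj.
have /allPn[w /mapP[j _ ->] w't] : ~~ all [in t] r.
  apply/negP=> /allP/(uniq_leq_size r_uniq).
  by rewrite size_map size_enum_ord size_image leqNgt Sq.
exists (z ^+ j) => [|i Si]; first by rewrite exprAC (prim_expr_order pr_z) expr1n.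
by apply: contraNneq w't => <-; apply: image_f.
Qed.

(** Put [F s] for the sum of the [x i * (x i ^+ m) ^+ s].  As [s] runs over the
    residues modulo [q], the discrete Fourier transform of [F] at a [q]-th root
    of unity [v] is [q] times the sum of the [x i] with [x i ^+ m = v].  Galois
    conjugation makes [F] vanish except possibly at one [s0], so all these class
    sums vanish as soon as one does; and since there are more [q]-th roots of
    unity than terms, some class is empty. *)
Lemma vanishing_class_sum (q m : nat) (I : finType) (S : {set I})
    (x : I -> algC) (w : algC) :
  prime q -> (0 < m)%N -> (#|S| < q)%N ->
  {in S, forall i, x i ^+ (q * m) = 1} -> \sum_(i in S) x i = 0 ->
  \sum_(i in S | x i ^+ m == w) x i = 0.
Proof.
move=> q_pr m_gt0 Sq x1 sx0; have q_gt0 := prime_gt0 q_pr.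
have y1 i: i \in S -> (x i ^+ m) ^+ q = 1 by move/x1; rewrite mulnC exprM.
have [s0 cop] := coprime_but_one q_pr m_gt0.
pose F (s : nat) := \sum_(i in S) x i * (x i ^+ m) ^+ s.
have F0 (s : 'I_q) : s != s0 -> F s = 0.
  move/cop=> /(galois_vanishing_sum x1 sx0) <-.
  by apply: eq_bigr => i _; rewrite exprD expr1 exprM.
have inversion v : v ^+ q = 1 ->
    q%:R * (\sum_(i in S | x i ^+ m == v) x i) = v^-1 ^+ s0 * F s0.
  move=> v1; have v_neq0: v != 0.
    by apply: contra_eq_neq v1 => ->; rewrite expr0n gtn_eqF // eq_sym oner_eq0.
  transitivity (\sum_(s < q) v^-1 ^+ s * F s); last first.
    by rewrite (bigD1 s0) //= big1 ?addr0 // => s /F0->; rewrite mulr0.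
  under [RHS]eq_bigr => s _ do rewrite mulr_sumr.
  rewrite exchange_big /= mulr_sumr big_mkcondr /=; apply: eq_bigr => i Si.
  transitivity (x i * \sum_(s < q) (v^-1 * x i ^+ m) ^+ s).
    rewrite sum_expr_unity_root; last by rewrite exprMn exprVn v1 invr1 mul1r y1.
    have ->: (v^-1 * x i ^+ m == 1) = (x i ^+ m == v).
      by rewrite -[RHS](inj_eq (mulfI (invr_neq0 v_neq0))) mulVf.
    by case: eqP => _; rewrite ?mulr0 // mulr1n mulrC.
  by rewrite mulr_sumr; apply: eq_bigr => s _; rewrite exprMn mulrCA.
have [v v1 v'y] := root_of_unity_avoiding (fun i => x i ^+ m) Sq.
have Fs0: F s0 = 0.
  have /eqP := inversion v v1; rewrite big_pred0 => [|i]; last first.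
    by apply/negbTE/negP=> /andP[/v'y/negP].
  rewrite mulr0 eq_sym mulf_eq0 expf_eq0 invr_eq0 => /orP[/andP[_ /eqP v0]|/eqP //].
  by move: v1 (oner_neq0 algC) => <-; rewrite v0 expr0n gtn_eqF // eqxx.
have [w1 | w1] := eqVneq (w ^+ q) 1.
  have /eqP := inversion w w1; rewrite Fs0 mulr0 mulf_eq0 pnatr_eq0 gtn_eqF //.
  by move/eqP.
rewrite big_pred0 // => i; apply/negbTE; apply: contra w1 => /andP[Si /eqP<-].
by rewrite y1.
Qed.

(** By induction on [n]: a prime [q != p] dividing [n] splits the sum into
    vanishing subsums, each proportional to a sum of [n / q]-th roots of unity,
    and the divisibility by [p] adds up over the subsums. *)
Lemma vanishing_sum_dvd (p n : nat) (I : finType) (S : {set I})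
    (x : I -> algC) :
  prime p -> (0 < n)%N ->
  (forall q, prime q -> (q %| n)%N -> q != p -> (#|S| < q)%N) ->
  {in S, forall i, x i ^+ n = 1} -> \sum_(i in S) x i = 0 -> (p %| #|S|)%N.
Proof.
move=> p_pr; have [r] := ubnP n; elim: r => // r IHr in n S x *.
rewrite ltnS => le_nr n_gt0 large x1 sx0.
have [/p_natP[e En] | ] := boolP (p.-nat n).
  by rewrite En in x1; apply: prime_power_vanishing_sum x1 sx0.
rewrite /pnat n_gt0 => /allPn[q]; rewrite mem_primes => /and3P[q_pr _ q_n] q'p.
have Sq := large q q_pr q_n q'p.
case/dvdnP: q_n => m; rewrite mulnC => En; rewrite {n}En in le_nr n_gt0 large x1.
have m_gt0: (0 < m)%N by move: n_gt0; rewrite muln_gt0 => /andP[].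
rewrite (card_partition (preim_partitionP (fun i => x i ^+ m) S)).
apply: dvdn_sum => _ /imsetP[i0 Si0 ->]; set T := [set i in S | _].
have sTS: T \subset S by apply/subsetP=> i; rewrite inE => /andP[].
have x0_neq0: x i0 != 0.
  apply: contra_eq_neq (x1 _ Si0) => ->.
  by rewrite expr0n gtn_eqF // eq_sym oner_eq0.
apply: (IHr m T (fun i => x i / x i0)) => //.
- by apply: leq_trans le_nr; rewrite ltn_Pmull ?prime_gt1.
- move=> l l_pr l_m l'p; apply: leq_ltn_trans (subset_leq_card sTS) _.
  by apply: large; rewrite ?dvdn_mull.
- move=> i; rewrite inE => /andP[_ /eqP Exi].
  by rewrite exprMn exprVn Exi divff // -Exi expf_neq0.
rewrite -mulr_suml -[X in X / _]/(\sum_(i in T) x i).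
rewrite (eq_bigl (fun i => (i \in S) && (x i ^+ m == x i0 ^+ m))) => [|i].
  by rewrite (vanishing_class_sum _ q_pr) ?mul0r.
by rewrite inE [_ == x i ^+ m]eq_sym.
Qed.

End VanishingSums.

(** * Determinants, permanents and characters *)

Section Characters.

Import GRing.Theory Num.Theory.
Local Open Scope ring_scope.

Definition permanent (R : comPzRingType) (k : nat) (B : 'M[R]_k) : R :=
  \sum_(s : 'S_k) \prod_i B i (s i).

(** In the Leibniz expansion over [t], the [B]-part of a term is the product of
    the [B i (s (t i))]; reindexing the sum over [s] by [t^-1 * s] frees it from
    [t] and turns it into the permanent. *)
Lemma sum_det_hadamard (R : comPzRingType) (k : nat) (A B : 'M[R]_k) :
  \sum_(s : 'S_k) \det (\matrix_(i, j) (A i j * B i (s j)))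
    = \det A * permanent B.
Proof.
rewrite /determinant exchange_big mulr_suml /=; apply: eq_bigr => t _.
rewrite /permanent mulr_sumr (reindex_inj (mulgI t^-1%g)) /=.
apply: eq_bigr => s _; rewrite -mulrA -big_split /=; congr (_ * _).
by apply: eq_bigr => i _; rewrite mxE permM permK.
Qed.

(** Second orthogonality exhibits a left inverse of the [k] columns of the
    character table indexed by the [a j], so they have rank [k] and contain an
    invertible square submatrix. *)
Lemma independent_characters (gT : finGroupType) (G : {group gT}) (k : nat)
    (a : 'I_k -> gT) :
  abelian G -> injective a -> (forall i, a i \in G) ->
  exists f : 'I_k -> Iirr G, \det (\matrix_(i, j) 'chi_(f i) (a j)) != 0.
Proof.
move=> abG a_inj Ga.
pose X : 'M[algC]_(Nirr G, k) := \matrix_(i, j) 'chi_i (a j).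
have fullX: row_full X.
  apply/row_fullP; exists (\matrix_(j, i) (#|G|%:R^-1 * ('chi_i (a j))^*)).
  apply/matrixP=> j l; rewrite !mxE.
  transitivity (#|G|%:R^-1 * \sum_i 'chi[G]_i (a l) * ('chi_i (a j))^*).
    rewrite mulr_sumr; apply: eq_bigr => i _.
    by rewrite !mxE -mulrA [X in _ * X]mulrC.
  rewrite second_orthogonality_relation // (abelian_classP _ abG) // inE.
  rewrite (inj_eq a_inj) eq_sym; case: eqP => _; last by rewrite mulr0.
  have /setIidPl -> : G \subset 'C[a l]%g.
    by rewrite sub_cent1 (subsetP abG).
  by rewrite mulVf // neq0CG.
exists (fullrankfun fullX); have := fullrowsub_unit fullX.
rewrite unitmxE unitfE; congr (\det _ != 0).
by apply/matrixP=> i j; rewrite !mxE.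
Qed.

(** The permanent has [k`!] terms, and the smallest prime divisor of [n], being
    larger than [k], does not divide that number. *)
Lemma permanent_root_of_unity_neq0 (k n : nat) (B : 'M[algC]_k) :
  k_large k n -> (forall i j, B i j ^+ n = 1) -> permanent B != 0.
Proof.
case=> n_gt1 k_lt large B1; apply/eqP=> perB0.
have p_pr : prime (pdiv n) by apply: pdiv_prime.
suff: (pdiv n %| k`!)%N.
  apply/negP; elim: k k_lt {large B B1 perB0} => [|k IHk] k_lt.
    by rewrite fact0 dvdn1 gtn_eqF ?prime_gt1.
  by rewrite factS Euclid_dvdM // negb_or gtnNdvd // IHk // ltnW.
have card_S : #|[set: 'S_k]| = k`! by rewrite cardsT card_Sn.
rewrite -card_S.
apply: (@vanishing_sum_dvd _ n _ _ (fun s : 'S_k => \prod_i B i (s i))) => //.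
- exact: ltnW.
- by move=> q; rewrite card_S; apply: large.
- by move=> s _; rewrite -prodrXl big1.
- by rewrite -[RHS]perB0; apply: eq_bigl => s; rewrite inE.
Qed.

Lemma distinct_products_of_character_det (gT : finGroupType) (G : {group gT})
    (k : nat) (a b : 'I_k -> gT) (f : 'I_k -> Iirr G) :
  abelian G -> (forall i, a i \in G) -> (forall i, b i \in G) ->
  \det (\matrix_(i, j) 'chi_(f i) (a j)) != 0 ->
  permanent (\matrix_(i, j) 'chi_(f i) (b j)) != 0 ->
  exists s : 'S_k, injective (fun i => a i * b (s i))%g.
Proof.
move=> abG Ga Gb detA perB.
have : \det (\matrix_(i, j) 'chi_(f i) (a j))
     * permanent (\matrix_(i, j) 'chi_(f i) (b j)) != 0 by rewrite mulf_neq0.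
rewrite -sum_det_hadamard => sum_neq0.
have [s det_s] : exists s : 'S_k,
    \det (\matrix_(i, j) 'chi_(f i) (a j * b (s j))%g) != 0.
  apply/existsP; apply: contraNT sum_neq0 => /existsPn det0.
  rewrite big1 // => s _; apply/eqP; rewrite -[_ == 0]negbK.
  apply: contra (det0 s).
  congr (\det _ != 0); apply/matrixP=> i j; rewrite !mxE lin_charM //.
  exact/char_abelianP.
(* Equal products would give two equal columns. *)
exists s => j l /= Ejl; apply/eqP; apply: contraNT det_s => jl.
rewrite -det_tr (determinant_alternate jl) // => i.
by rewrite !mxE Ejl.
Qed.

Lemma distinct_products_right_in_subgroup (gT : finGroupType)
    (G H : {group gT}) (k : nat) (a b : 'I_k -> gT) :
  abelian G -> H \subset G -> k_large k #|H| ->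
  injective a -> (forall i, a i \in G) -> (forall i, b i \in H) ->
  exists s : 'S_k, injective (fun i => a i * b (s i))%g.
Proof.
move=> abG sHG Hlarge a_inj Ga Hb.
have Gb i : b i \in G by apply: (subsetP sHG).
have [f detA] := independent_characters abG a_inj Ga.
apply: (distinct_products_of_character_det abG Ga Gb detA).
apply: (permanent_root_of_unity_neq0 Hlarge) => i j; rewrite mxE.
have lin : 'chi_(f i) \is a linear_char by apply/char_abelianP.
by rewrite -(lin_charX lin _ (Gb j)) expg_cardG // lin_char1.
Qed.

End Characters.

(** * Retraction onto a subgroup *)

Section CosetRetraction.

Local Open Scope group_scope.

(** Every coset of [H] is identified with [H] through its chosen representative;
    this retraction is [H]-equivariant, though not a homomorphism in general. *)
Definition coset_retract (gT : finGroupType) (H : {group gT}) (x : gT) : gT :=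
  x * (repr (H :* x))^-1.

Lemma coset_retract_in (gT : finGroupType) (H : {group gT}) (x : gT) :
  coset_retract H x \in H.
Proof.
rewrite /coset_retract -groupV invMg invgK -mem_rcoset.
exact: mem_repr_rcoset.
Qed.

Lemma coset_retractM (gT : finGroupType) (H : {group gT}) (h x : gT) :
  h \in H -> coset_retract H (h * x) = h * coset_retract H x.
Proof. by move=> Hh; rewrite /coset_retract rcosetM (rcoset_id Hh) mulgA. Qed.

End CosetRetraction.

Theorem theorem1p6 (gT : finGroupType) (G : {group gT}) (k : nat)
    (a b : 'I_k -> gT) (H : {group gT}) :
  abelian G ->
  0 < k ->
  injective a ->
  (forall i, a i \in G) ->
  (forall i, b i \in G) ->
  H \subset G ->
  k_large k #|H| ->
  (forall i, a i \in H) \/ (forall i, b i \in H) ->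
  exists pi : 'S_k, injective (fun i : 'I_k => (a i * b (pi i))%g).
Proof.
move=> abG _ a_inj Ga Gb sHG Hlarge [Ha | Hb]; last first.
  exact: distinct_products_right_in_subgroup abG sHG Hlarge a_inj Ga Hb.
have Hrb i := coset_retract_in H (b i).
have [s rs_inj] :=
  distinct_products_right_in_subgroup abG sHG Hlarge a_inj Ga Hrb.
exists s => i j /= Eij; apply: rs_inj.
by rewrite /= -!coset_retractM // Eij.
Qed.
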